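(* Let $p\ge3$ be odd, $q$ a primitive $p$-th root of unity with $q^{1/2}$ chosen so that $(q^{1/2})^p=-1$, and let $\chi_+,\chi_-\in\mathbb C$. Put $p_+'=q^{-\frac12}p_+\kappa^{-1}$ and $p_-'=q^{-\frac12}p_-\kappa$ in $U_q(e(1,1))$. The eigenfunctions in $A(E_q^{(1,1)})$ of the simultaneous eigenvalue equations $$\mathcal R(p_+')Y=\chi_+Y,\qquad \mathcal R(p_-')Y=\chi_-Y$$ are, up to a constant factor, $$Y=e_+^{-i\chi_+\eta_+}\;e_+^{-iq\chi_-\eta_-}\;e^{i\chi_+^pz_+}\,e^{i\chi_-^pz_-},$$ where $e_+^x=\sum_{m=0}^{p-1}\frac{q^{m(m-1)/2}}{[m]!}x^m$ is the cut-off $q$-exponential.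
   Context: $[n]=\frac{q^n-q^{-n}}{q-q^{-1}}$, $[n]!=[1]\cdots[n]$, $[0]!=1$. The quantum plane $A(E_q^{(1,1)})$ is the algebra of finite sums of $\eta_+^a\eta_-^bf$ with $a,b\in\{0,\dots,p-1\}$ and $f$ a smooth complex function of $(z_+,z_-)\in\mathbb R^2$, where functions of $z_\pm$ commute with $\eta_\pm$, and $\eta_-\eta_+=q^2\eta_+\eta_-$, $\eta_\pm^p=0$. $U_q(e(1,1))$ is the algebra generated by $p_\pm,\kappa$ with $p_+p_-=p_-p_+$, $p_\pm\kappa=q^{\mp1}\kappa p_\pm$, $\kappa^p=1$. Its right representation $\mathcal R$ on $A(E_q^{(1,1)})$ is the antihomomorphism ($\mathcal R(\phi\phi')=\mathcal R(\phi')\mathcal R(\phi)$) determined by $$\mathcal R(p_\pm)\eta_\pm^k=iq^{\pm\frac12}[k]\eta_\pm^{k-1},\quad \mathcal R(p_\pm)\eta_\mp^k=0,\quad \mathcal R(\kappa)\eta_\pm^k=q^{\pm k}\eta_\pm^k,$$ $$\mathcal R(p_\pm)f=iq^{\pm\frac12}\frac{(-1)^{\frac{p+1}2}}{[p-1]!}\,\eta_\pm^{p-1}\frac{\partial f}{\partial z_\pm},\quad \mathcal R(p_\pm^p)f=i\frac{\partial f}{\partial z_\pm},\quad \mathcal R(\kappa)f=f,$$ $$\mathcal R(p_\pm)(XY)=\mathcal R(p_\pm)X\cdot\mathcal R(\kappa)Y+\mathcal R(\kappa^{-1})X\cdot\mathcal R(p_\pm)Y,\quad \mathcal R(\kappa)(XY)=\mathcal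 R(\kappa)X\cdot\mathcal R(\kappa)Y .$$ *)

(* Defs.v *)
From HB Require Import structures.
From mathcomp Require Import all_boot all_order all_algebra generic_quotient.
From mathcomp Require Import all_classical all_reals all_analysis.
From mathcomp.real_closed Require Import complex.
From mathcomp Require Import ring.

Set Implicit Arguments.
Unset Strict Implicit.
Unset Printing Implicit Defensive.

Import Order.TTheory GRing.Theory Num.Theory.
Import numFieldNormedType.Exports.

Local Open Scope classical_set_scope.
Local Open Scope ring_scope.
Local Open Scope complex_scope.
Local Open Scope quotient_scope.

Section SmoothFunctions.
Variable R : realType.
Local Notation C := R[i].

(* Throughout, a boolean [s] stands for the index + ([true]) or - ([false]). *)
Definition axis (s : bool) : R * R := if s then (1, 0) else (0, 1).

Definition coordinate (s : bool) (z : R * R) : R := if s then z.1 else z.2.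

Fixpoint Ck (n : nat) (u : R * R -> R) : Prop :=
  continuous u /\
  if n is m.+1 then
    forall s, (forall z, derivable u z (axis s)) /\ Ck m ('D_(axis s) u)
  else True.

Definition smooth (f : R * R -> C) : Prop :=
  forall n, Ck n (fun z => complex.Re (f z)) /\ Ck n (fun z => complex.Im (f z)).

Lemma Ck_continuous n u : Ck n u -> continuous u.
Proof. by case: n => [|n] []. Qed.

Lemma CkS n u : Ck n.+1 u -> Ck n u.
Proof.
elim: n u => [|n IH] u [cu h]; first by split.
split=> // s; have [d e] := h s; split=> //; exact: IH.
Qed.

Lemma Ck_cst n (a : R) : Ck n (fun=> a).
Proof.
elim: n a => [|n IH] a; split=> //; try by move=> z; exact: cvg_cst.
move=> s; split=> [z|]; first exact: derivable_cst.
rewrite (_ : 'D_(axis s) (fun=> a) = fun=> 0) //.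
by apply/funext => z; rewrite derive_cst.
Qed.

Lemma CkD n u v : Ck n u -> Ck n v -> Ck n (fun z => u z + v z).
Proof.
elim: n u v => [|n IH] u v [cu hu] [cv hv].
  by split=> // z; apply: cvgD; [exact: cu|exact: cv].
split; first by move=> z; apply: cvgD; [exact: cu|exact: cv].
move=> s; have [du eu] := hu s; have [dv ev] := hv s.
split=> [z|]; first exact: derivableD.
rewrite (_ : 'D_(axis s) _ = fun z => 'D_(axis s) u z + 'D_(axis s) v z).
  exact: IH.
by apply/funext => z; rewrite deriveD.
Qed.

Lemma CkM n u v : Ck n u -> Ck n v -> Ck n (fun z => u z * v z).
Proof.
elim: n u v => [|n IH] u v hu0 hv0; move: (hu0) (hv0) => [cu hu] [cv hv].
  by split=> // z; apply: cvgM; [exact: cu|exact: cv].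
split; first by move=> z; apply: cvgM; [exact: cu|exact: cv].
move=> s; have [du eu] := hu s; have [dv ev] := hv s.
split=> [z|]; first exact: derivableM.
rewrite (_ : 'D_(axis s) _ = fun z => u z * 'D_(axis s) v z + v z * 'D_(axis s) u z).
  by apply: CkD; apply: IH => //; exact: CkS.
by apply/funext => z; rewrite deriveM.
Qed.

Lemma CkN n u : Ck n u -> Ck n (fun z => - u z).
Proof.
move=> hu; have := CkM (Ck_cst n (-1)) hu.
by congr Ck; apply/funext => z; rewrite mulN1r.
Qed.

Lemma Ck_eq n u v : u =1 v -> Ck n u -> Ck n v.
Proof. by move=> /funext ->. Qed.

Lemma smooth_cst (a : C) : smooth (cst a).
Proof. by move=> n; split; exact: Ck_cst. Qed.

Lemma smoothB f g : smooth f -> smooth g -> smooth (f - g).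
Proof.
move=> hf hg n; have [rf jf] := hf n; have [rg jg] := hg n.
split; [apply: Ck_eq (CkD rf (CkN rg))|apply: Ck_eq (CkD jf (CkN jg))] => z /=;
  by rewrite -[(f - g) z]/(f z - g z); case: (f z) (g z) => [? ?] [? ?].
Qed.

Lemma smoothM f g : smooth f -> smooth g -> smooth (f * g).
Proof.
move=> hf hg n; have [rf jf] := hf n; have [rg jg] := hg n.
split; [apply: Ck_eq (CkD (CkM rf rg) (CkN (CkM jf jg)))
  |apply: Ck_eq (CkD (CkM rf jg) (CkM jf rg))] => z /=;
  by rewrite -[(f * g) z]/(f z * g z); case: (f z) (g z) => [? ?] [? ?].
Qed.

Definition smooth_pred : {pred (R * R -> C)} := fun f => `[< smooth f >].

Lemma smooth_predP f : reflect (smooth f) (f \in smooth_pred).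
Proof. exact: asboolP. Qed.

Fact smooth_subring : subring_closed smooth_pred.
Proof.
split=> [|f g /smooth_predP hf /smooth_predP hg|
          f g /smooth_predP hf /smooth_predP hg]; apply/smooth_predP.
- exact: smooth_cst.
- exact: smoothB.
- exact: smoothM.
Qed.
HB.instance Definition _ :=
  GRing.isSubringClosed.Build (R * R -> C)%type smooth_pred smooth_subring.

Fact smooth_scaler : scaler_closed smooth_pred.
Proof.
move=> a f /smooth_predP hf; apply/smooth_predP.
exact: smoothM (smooth_cst a) hf.
Qed.
HB.instance Definition _ :=
  GRing.isScaleClosed.Build C (R * R -> C)%type smooth_pred smooth_scaler.

Record smoothFun := SmoothFun {
  smooth_val :> R * R -> C;
  smooth_valP : smooth_val \in smooth_pred }.

HB.instance Definition _ := [isSub for smooth_val].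
HB.instance Definition _ := [Choice of smoothFun by <:].
HB.instance Definition _ :=
  [SubChoice_isSubComNzRing of smoothFun by <:].
HB.instance Definition _ := [SubZmodule_isSubLmodule of smoothFun by <:].

Fact smooth_scalerAl (a : C) (f g : smoothFun) : a *: (f * g) = (a *: f) * g.
Proof. by apply: val_inj; apply/funext => z /=; exact: mulrA. Qed.
HB.instance Definition _ :=
  GRing.Lmodule_isLalgebra.Build C smoothFun smooth_scalerAl.
HB.instance Definition _ := GRing.Lalgebra_isComAlgebra.Build C smoothFun.

Definition pderiv_fun (s : bool) (f : R * R -> C) (z : R * R) : C :=
  'D_(axis s) (fun t => complex.Re (f t)) z +i*
  'D_(axis s) (fun t => complex.Im (f t)) z.

Fact pderiv_smooth s (f : smoothFun) : pderiv_fun s f \in smooth_pred.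
Proof.
have /smooth_predP hf := smooth_valP f; apply/smooth_predP => n.
by have [[_ /(_ s)[_ hr]] [_ /(_ s)[_ hi]]] := hf n.+1; split.
Qed.

Definition pderiv (s : bool) (f : smoothFun) : smoothFun :=
  SmoothFun (pderiv_smooth s f).

Definition cexp (w : C) : C :=
  (expR (complex.Re w) * cos (complex.Im w)) +i*
  (expR (complex.Re w) * sin (complex.Im w)).

Lemma is_derive_coordinate (h : R -> R) (dh : R) z s s' :
  is_derive (coordinate s z) (1 : R) h dh ->
  is_derive z (axis s') (fun t => h (coordinate s t)) (if s == s' then dh else 0).
Proof.
have [<- hd|ss'] := eqVneq s s'.
  have E : (fun k : R => k^-1 *: (((fun t => h (coordinate s t)) \o shift z)
        (k *: axis s) - h (coordinate s z))) =
      (fun k : R => k^-1 *: ((h \o shift (coordinate s z)) (k *: (1 : R)) -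
        h (coordinate s z))).
    by apply/funext => k; case: s {hd}.
  by case: hd => dr vl; split; [rewrite /derivable E|rewrite /derive E].
move=> _; rewrite -[fun t => _]/(h \o coordinate s).
have E : (fun k : R => k^-1 *: (((h \o coordinate s) \o shift z)
      (k *: axis s') - (h \o coordinate s) z)) = (fun=> 0).
  apply/funext => k; case: s s' ss' => [] [] //= _;
    by rewrite /shift /= scaler0 add0r subrr scaler0.
split; rewrite /derivable /derive E; first exact: is_cvg_cst.
exact: lim_cst.
Qed.

Lemma Ck_expcos n s (a b c d : R) :
  Ck n (fun z => expR (a * coordinate s z) *
    (c * cos (b * coordinate s z) + d * sin (b * coordinate s z))).
Proof.
pose F c d (t : R) := expR (a * t) * (c * cos (b * t) + d * sin (b * t)).
have lin (k x : R) : is_derive x (1 : R) (fun t : R => k * t) k.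
  by apply: is_derive_eq; rewrite /GRing.scale /= mulr1.
have der (c' d' x : R) :
    is_derive x (1 : R) (F c' d') (F (a * c' + b * d') (a * d' - b * c') x).
  have he : is_derive x (1 : R) (fun t : R => expR (a * t)) (a * expR (a * x)).
    by rewrite mulrC; apply: (@is_derive1_comp _ expR (fun t : R => a * t)).
  have hc : is_derive x (1 : R) (fun t : R => cos (b * t)) (b * - sin (b * x)).
    by rewrite mulrC; apply: (@is_derive1_comp _ (@cos R) (fun t : R => b * t)).
  have hs : is_derive x (1 : R) (fun t : R => sin (b * t)) (b * cos (b * x)).
    by rewrite mulrC; apply: (@is_derive1_comp _ (@sin R) (fun t : R => b * t)).
  have := is_deriveM he (is_deriveD (is_deriveZ c' hc) (is_deriveZ d' hs)).
  rewrite -[X in is_derive _ _ X _]/(F c' d') => H.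
  apply: (@is_derive_eq _ _ _ _ _ _ _ _ H).
  by rewrite /F !fctE /= /GRing.scale /=; ring.
change (Ck n (fun z => F c d (coordinate s z))).
have cts c' d' : continuous (fun z => F c' d' (coordinate s z)).
  have coordc : continuous (coordinate s).
    by case: (s) => z; [exact: cvg_fst|exact: cvg_snd].
  move=> z; apply: continuous_comp; first exact: coordc.
  apply/differentiable_continuous/derivable1_diffP.
  by have [] := der c' d' (coordinate s z).
elim: n c d => [|n IH] c d; split=> // s'; split=> [z|].
  by have [] := is_derive_coordinate s' (der c d (coordinate s z)).
have -> : 'D_(axis s') (fun z => F c d (coordinate s z)) =
    fun z => if s == s' then F (a * c + b * d) (a * d - b * c) (coordinate s z)
             else 0.
  apply/funext => z.
  by have [_] := is_derive_coordinate s' (der c d (coordinate s z)).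
case: (s == s'); [exact: IH|exact: Ck_cst].
Qed.

Fact expwave_smooth (s : bool) (w : C) :
  (fun z : R * R => cexp (w * (coordinate s z)%:C)) \in smooth_pred.
Proof.
apply/smooth_predP => n; case: w => a b; split.
  apply: Ck_eq (Ck_expcos n s a b 1 0) => z /=.
  by rewrite !mulr0 subr0 add0r mul0r addr0 mul1r.
apply: Ck_eq (Ck_expcos n s a b 0 1) => z /=.
by rewrite !mulr0 subr0 add0r mul0r add0r mul1r.
Qed.

(* The function (z_+, z_-) |-> e^{w z_s}. *)
Definition expwave (s : bool) (w : C) : smoothFun :=
  SmoothFun (expwave_smooth s w).

End SmoothFunctions.

Section QNumbers.
Variable (K : fieldType) (q : K).

Definition qnum (n : nat) : K := (q ^+ n - q ^- n) / (q - q^-1).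

Definition qfact (n : nat) : K := \prod_(1 <= k < n.+1) qnum k.

End QNumbers.

(* The family [Y] stands for the sum over (a, b) of eta_+^a eta_-^b Y(a, b),
   with coefficients in the commutative algebra [S]; see [qplane_expansion].
   The parameter [q] only enters the product. *)
Definition qplane (K : fieldType) (S : comAlgType K) (p : nat) (q : K) : Type :=
  {ffun 'I_p * 'I_p -> S}.

Section QuantumPlane.
Variables (K : fieldType) (S : comAlgType K) (p : nat) (q : K).
Local Notation A := (qplane S p q).
Local Notation idx := ('I_p * 'I_p)%type.

HB.instance Definition _ := GRing.Lmodule.copy A {ffun 'I_p * 'I_p -> S}.

Definition mono (a b : nat) (f : S) : A :=
  [ffun m : idx => if (m.1 == a :> nat) && (m.2 == b :> nat) then f else 0].

(* (eta_+^a eta_-^b f) (eta_+^a' eta_-^b' g)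
     = q^(2 b a') eta_+^(a + a') eta_-^(b + b') f g *)
Definition qplane_mul (X Y : A) : A :=
  \sum_(i : idx) \sum_(j : idx)
    mono (i.1 + j.1) (i.2 + j.2) (q ^+ (2 * (i.2 * j.1)) *: (X i * Y j)).

Lemma mono_linear a b : linear (mono a b).
Proof.
by move=> c f g; apply/ffunP => m; rewrite !ffunE; case: ifP; rewrite ?scaler0 ?addr0.
Qed.
HB.instance Definition _ a b :=
  GRing.isLinear.Build K S A *:%R (mono a b) (mono_linear a b).

Lemma mono_ge a b f : (p <= a)%N || (p <= b)%N -> mono a b f = 0.
Proof.
move=> h; apply/ffunP => -[[i hi] [j hj]]; rewrite !ffunE /=.
case: ifP => // /andP[/eqP ia /eqP jb]; move: h.
by rewrite -ia -jb !(leqNgt p) hi hj.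
Qed.

Lemma qplaneE (X : A) : X = \sum_(i : idx) mono i.1 i.2 (X i).
Proof.
apply/ffunP => m; rewrite sum_ffunE (bigD1 m) //= ffunE !eqxx /= big1 ?addr0 //.
move=> i im; rewrite ffunE; case: ifP => // /andP[/eqP e1 /eqP e2].
by case/eqP: im; case: m i e1 e2 => [m1 m2] [i1 i2] /= /val_inj-> /val_inj->.
Qed.

Lemma qplane_mul_mono a b f a' b' g :
  qplane_mul (mono a b f) (mono a' b' g) =
  mono (a + a') (b + b') (q ^+ (2 * (b * a')) *: (f * g)).
Proof.
have [/andP[ha hb]|] := boolP ((a < p)%N && (b < p)%N); last first.
  rewrite negb_and -!leqNgt => h; rewrite (mono_ge _ h) [RHS]mono_ge; last first.
    by case/orP: h => h; rewrite (leq_trans h (leq_addr _ _)) ?orbT.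
  by rewrite /qplane_mul big1 // => i _; rewrite big1 // => j _;
    rewrite ffunE mul0r scaler0 linear0.
have [/andP[ha' hb']|] := boolP ((a' < p)%N && (b' < p)%N); last first.
  rewrite negb_and -!leqNgt => h; rewrite (mono_ge g h) [RHS]mono_ge; last first.
    by case/orP: h => h; rewrite (leq_trans h (leq_addl _ _)) ?orbT.
  by rewrite /qplane_mul big1 // => i _; rewrite big1 // => j _;
    rewrite [X in _ * X]ffunE mulr0 scaler0 linear0.
have neq (x y : idx) : x != y ->
    ((x.1 == y.1 :> nat) && (x.2 == y.2 :> nat)) = false.
  move=> xy; apply/negbTE; apply: contra xy.
  by case: x y => [x1 x2] [y1 y2] /= /andP[/eqP/val_inj-> /eqP/val_inj->].
rewrite /qplane_mul (bigD1 (Ordinal ha, Ordinal hb)) //= [X in _ + X]big1 ?addr0.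
  rewrite (bigD1 (Ordinal ha', Ordinal hb')) //= [X in _ + X]big1 ?addr0.
    by rewrite !ffunE /= !eqxx.
  move=> j hj; rewrite [mono a' _ _ _]ffunE.
  by have /= -> := neq _ _ hj; rewrite mulr0 scaler0 linear0.
move=> i hi; rewrite big1 // => j _; rewrite [mono a _ _ _]ffunE.
by have /= -> := neq _ _ hi; rewrite mul0r scaler0 linear0.
Qed.

Fact qplane_mulDl : left_distributive qplane_mul +%R.
Proof.
move=> X Y Z; rewrite /qplane_mul -big_split; apply: eq_bigr => i _ /=.
rewrite -big_split; apply: eq_bigr => j _ /=.
by rewrite -linearD -scalerDr -mulrDl ffunE.
Qed.

Fact qplane_mulDr : right_distributive qplane_mul +%R.
Proof.
move=> X Y Z; rewrite /qplane_mul -big_split; apply: eq_bigr => i _ /=.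
rewrite -big_split; apply: eq_bigr => j _ /=.
by rewrite -linearD -scalerDr -mulrDr ffunE.
Qed.

Fact qplane_mulZl c X Y : qplane_mul (c *: X) Y = c *: qplane_mul X Y.
Proof.
rewrite /qplane_mul scaler_sumr; apply: eq_bigr => i _ /=.
rewrite scaler_sumr; apply: eq_bigr => j _ /=.
by rewrite -linearZ ffunE -scalerAl !scalerA mulrC.
Qed.

Fact qplane_mulZr c X Y : qplane_mul X (c *: Y) = c *: qplane_mul X Y.
Proof.
rewrite /qplane_mul scaler_sumr; apply: eq_bigr => i _ /=.
rewrite scaler_sumr; apply: eq_bigr => j _ /=.
by rewrite -linearZ ffunE -scalerAr !scalerA mulrC.
Qed.

Fact qplane_mul_suml (I : finType) (F : I -> A) Y :
  qplane_mul (\sum_i F i) Y = \sum_i qplane_mul (F i) Y.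
Proof.
apply: (big_morph (qplane_mul^~ Y)) => [X X'|]; first exact: qplane_mulDl.
by rewrite -(scale0r 0) qplane_mulZl !scale0r.
Qed.

Fact qplane_mul_sumr (I : finType) (F : I -> A) Y :
  qplane_mul Y (\sum_i F i) = \sum_i qplane_mul Y (F i).
Proof.
apply: (big_morph (qplane_mul Y)) => [X X'|]; first exact: qplane_mulDr.
by rewrite -(scale0r 0) qplane_mulZr !scale0r.
Qed.

Fact qplane_mulA : associative qplane_mul.
Proof.
have mulmA a b f a' b' g a'' b'' h :
    qplane_mul (mono a b f) (qplane_mul (mono a' b' g) (mono a'' b'' h)) =
    qplane_mul (qplane_mul (mono a b f) (mono a' b' g)) (mono a'' b'' h).
  rewrite !qplane_mul_mono !addnA; congr mono.
  rewrite -!scalerAl -!scalerAr !scalerA -!exprD mulrA; congr (_ ^+ _ *: _).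
  by ring.
move=> X Y Z; rewrite (qplaneE X) (qplaneE Y) (qplaneE Z).
move: qplane_mul qplane_mul_suml qplane_mul_sumr mulmA => mul suml sumr mulmA.
rewrite !suml; apply: eq_bigr => i _.
rewrite sumr [mul _ (\sum_j mono _ _ (Y j))]sumr suml; apply: eq_bigr => j _.
by rewrite !sumr; apply: eq_bigr => k _.
Qed.

Fact qplane_mul1 : left_id (mono 0 0 1) qplane_mul.
Proof.
move=> X; rewrite {1}(qplaneE X) qplane_mul_sumr {2}(qplaneE X).
apply: eq_bigr => i _.
by rewrite qplane_mul_mono !add0n mul0n muln0 expr0 scale1r mul1r.
Qed.

Fact qplane_mulr1 : right_id (mono 0 0 1) qplane_mul.
Proof.
move=> X; rewrite {1}(qplaneE X) qplane_mul_suml {2}(qplaneE X).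
apply: eq_bigr => i _.
by rewrite qplane_mul_mono !addn0 !muln0 expr0 scale1r mulr1.
Qed.

HB.instance Definition _ := GRing.Zmodule_isPzRing.Build A
  qplane_mulA qplane_mul1 qplane_mulr1 qplane_mulDl qplane_mulDr.

Definition eta (s : bool) : A := if s then mono 1 0 1 else mono 0 1 1.

Definition qplane_fun (f : S) : A := mono 0 0 f.

Lemma qplane_scalerAl (c : K) (X Y : A) : c *: (X * Y) = (c *: X) * Y.
Proof. exact/esym/qplane_mulZl. Qed.

Lemma qplane_scalerAr (c : K) (X Y : A) : c *: (X * Y) = X * (c *: Y).
Proof. exact/esym/qplane_mulZr. Qed.

Lemma mono_mul a b f a' b' g :
  mono a b f * mono a' b' g =
  mono (a + a') (b + b') (q ^+ (2 * (b * a')) *: (f * g)).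
Proof. exact: qplane_mul_mono. Qed.

Lemma eta_exp s k : eta s ^+ k = if s then mono k 0 1 else mono 0 k 1.
Proof.
elim: k => [|k IH]; first by case: s.
rewrite exprS IH /eta; case: s {IH}; rewrite mono_mul;
  by rewrite ?mul0n ?muln0 expr0 scale1r mulr1.
Qed.

Lemma eta_nilpotent s : eta s ^+ p = 0.
Proof. by rewrite eta_exp; case: s; rewrite mono_ge // leqnn ?orbT. Qed.

Lemma eta_comm : eta false * eta true = q ^+ 2 *: (eta true * eta false).
Proof. by rewrite /eta !mono_mul -linearZ /= mulr1 scale1r. Qed.

Lemma eta_fun_comm s f : eta s * qplane_fun f = qplane_fun f * eta s.
Proof.
by rewrite /eta /qplane_fun; case: s; rewrite !mono_mul mul1r mulr1 ?mul0n ?muln0.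
Qed.

Lemma qplane_funM f g : qplane_fun (f * g) = qplane_fun f * qplane_fun g.
Proof. by rewrite mono_mul expr0 scale1r. Qed.

Lemma qplane_expansion (Y : A) :
  Y = \sum_(m : idx) eta true ^+ m.1 * eta false ^+ m.2 * qplane_fun (Y m).
Proof.
rewrite {1}(qplaneE Y); apply: eq_bigr => m _.
by rewrite !eta_exp !mono_mul muln0 !expr0 !scale1r !mul1r !addn0 add0n.
Qed.

Definition qexp (x : A) : A :=
  \sum_(m < p) (q ^+ (m * m.-1)./2 / qfact q m) *: x ^+ m.

End QuantumPlane.

Section Uqe11.
Variables (K : fieldType) (p : nat) (q : K).

Definition pm (s : bool) : int := if s then 1 else - 1.

(* Noncommutative polynomial expressions in p_+, p_- and kappa. *)
Inductive uexpr : Type :=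
  | UConst of K
  | UP of bool
  | UKappa
  | UAdd of uexpr & uexpr
  | UMul of uexpr & uexpr.

Definition uexp (x : uexpr) (n : nat) : uexpr := iter n (UMul x) (UConst 1).

(* The congruence generated by the axioms of unital associative K-algebras
   and by the defining relations. *)
Inductive ueq : uexpr -> uexpr -> Prop :=
  | ueq_refl x : ueq x x
  | ueq_sym x y : ueq x y -> ueq y x
  | ueq_trans x y z : ueq x y -> ueq y z -> ueq x z
  | ueq_add x x' y y' : ueq x x' -> ueq y y' -> ueq (UAdd x y) (UAdd x' y')
  | ueq_mul x x' y y' : ueq x x' -> ueq y y' -> ueq (UMul x y) (UMul x' y')
  | ueq_addA x y z : ueq (UAdd x (UAdd y z)) (UAdd (UAdd x y) z)
  | ueq_addC x y : ueq (UAdd x y) (UAdd y x)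
  | ueq_add0 x : ueq (UAdd (UConst 0) x) x
  | ueq_mulA x y z : ueq (UMul x (UMul y z)) (UMul (UMul x y) z)
  | ueq_mul1 x : ueq (UMul (UConst 1) x) x
  | ueq_mul0 x : ueq (UMul (UConst 0) x) (UConst 0)
  | ueq_mulDl x y z : ueq (UMul (UAdd x y) z) (UAdd (UMul x z) (UMul y z))
  | ueq_mulDr x y z : ueq (UMul x (UAdd y z)) (UAdd (UMul x y) (UMul x z))
  | ueq_constD a b : ueq (UConst (a + b)) (UAdd (UConst a) (UConst b))
  | ueq_constM a b : ueq (UConst (a * b)) (UMul (UConst a) (UConst b))
  | ueq_constC a x : ueq (UMul (UConst a) x) (UMul x (UConst a))
  | ueq_pp : ueq (UMul (UP true) (UP false)) (UMul (UP false) (UP true))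
  | ueq_pkappa s : ueq (UMul (UP s) UKappa)
      (UMul (UConst (q ^ (- pm s))) (UMul UKappa (UP s)))
  | ueq_kappap : ueq (uexp UKappa p) (UConst 1).

HB.instance Definition _ := gen_eqMixin uexpr.
HB.instance Definition _ := gen_choiceMixin uexpr.

Definition ueqb (x y : uexpr) : bool := `[< ueq x y >].

Fact ueqb_equiv : equiv_class_of ueqb.
Proof.
split=> [x|x y|y x z]; first exact/asboolP/ueq_refl.
  by apply/asboolP/asboolP; exact: ueq_sym.
by move=> /asboolP xy /asboolP yz; apply/asboolP/(ueq_trans xy).
Qed.

Canonical ueqb_rel := EquivRelPack ueqb_equiv.

Definition Uqe11 : Type := {eq_quot ueqb_rel}.
HB.instance Definition _ := Choice.on Uqe11.
HB.instance Definition _ := EqQuotient.on Uqe11.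

Local Notation U := Uqe11.

Definition uclass (x : uexpr) : U := \pi_U x.

Lemma uclassP x y : uclass x = uclass y <-> ueq x y.
Proof.
rewrite /uclass; split=> [/eqmodP/asboolP //|xy]; exact/eqmodP/asboolP.
Qed.

Lemma ureprK x : uclass (repr x) = x. Proof. exact: reprK. Qed.

Lemma urepr_uclass x : ueq (repr (uclass x)) x.
Proof. by apply/uclassP; rewrite ureprK. Qed.

Definition uadd (x y : U) := uclass (UAdd (repr x) (repr y)).
Definition umul (x y : U) := uclass (UMul (repr x) (repr y)).
Definition uconst (a : K) := uclass (UConst a).

Lemma uaddE x y : uadd (uclass x) (uclass y) = uclass (UAdd x y).
Proof. by apply/uclassP/ueq_add; exact: urepr_uclass. Qed.

Lemma umulE x y : umul (uclass x) (uclass y) = uclass (UMul x y).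
Proof. by apply/uclassP/ueq_mul; exact: urepr_uclass. Qed.

Lemma uclass_ind (P : U -> Prop) : (forall x, P (uclass x)) -> forall u, P u.
Proof. by move=> h u; rewrite -[u]ureprK. Qed.

Fact uaddA : associative uadd.
Proof.
by do 3![elim/uclass_ind => ?]; rewrite !uaddE; apply/uclassP/ueq_addA.
Qed.
Fact uaddC : commutative uadd.
Proof. by do 2![elim/uclass_ind => ?]; rewrite !uaddE; apply/uclassP/ueq_addC. Qed.
Fact uadd0 : left_id (uconst 0) uadd.
Proof. by elim/uclass_ind => x; rewrite uaddE; apply/uclassP/ueq_add0. Qed.
Fact umulA : associative umul.
Proof.
by do 3![elim/uclass_ind => ?]; rewrite !umulE; apply/uclassP/ueq_mulA.
Qed.
Fact umul1 : left_id (uconst 1) umul.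
Proof. by elim/uclass_ind => x; rewrite umulE; apply/uclassP/ueq_mul1. Qed.
Fact umul0 : left_zero (uconst 0) umul.
Proof. by elim/uclass_ind => x; rewrite umulE; apply/uclassP/ueq_mul0. Qed.
Fact uconstC a x : umul (uconst a) x = umul x (uconst a).
Proof. by elim/uclass_ind: x => x; rewrite !umulE; apply/uclassP/ueq_constC. Qed.
Fact umulr1 : right_id (uconst 1) umul.
Proof. by move=> x; rewrite -uconstC umul1. Qed.
Fact umulDl : left_distributive umul uadd.
Proof.
by do 3![elim/uclass_ind => ?]; rewrite !(umulE, uaddE); apply/uclassP/ueq_mulDl.
Qed.
Fact umulDr : right_distributive umul uadd.
Proof.
by do 3![elim/uclass_ind => ?]; rewrite !(umulE, uaddE); apply/uclassP/ueq_mulDr.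
Qed.
Fact uconstD a b : uconst (a + b) = uadd (uconst a) (uconst b).
Proof. by rewrite uaddE; apply/uclassP/ueq_constD. Qed.
Fact uconstM a b : uconst (a * b) = umul (uconst a) (uconst b).
Proof. by rewrite umulE; apply/uclassP/ueq_constM. Qed.

Definition uopp (x : U) := umul (uconst (- 1)) x.
Fact uaddN : left_inverse (uconst 0) uopp uadd.
Proof.
by move=> x; rewrite /uopp -{2}[x]umul1 -umulDl -uconstD addNr umul0.
Qed.

HB.instance Definition _ := GRing.isZmodule.Build U uaddA uaddC uadd0 uaddN.

(* The character p_+, p_- |-> 0, kappa |-> 1. *)
Fixpoint ucounit (x : uexpr) : K :=
  match x with
  | UConst a => a
  | UP _ => 0
  | UKappa => 1
  | UAdd x y => ucounit x + ucounit y
  | UMul x y => ucounit x * ucounit y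
  end.

Lemma ucounit_ueq x y : ueq x y -> ucounit x = ucounit y.
Proof.
elim => //= {x y}; try by move=> *; congruence.
all: try by move=> *; rewrite ?addrA ?add0r ?mulrA ?mul1r ?mul0r ?mulrDl ?mulrDr.
- by move=> x y; rewrite addrC.
- by move=> a x; rewrite mulrC.
- by move=> s; rewrite mul0r !mulr0.
- by elim: p => //= n ->; rewrite mulr1.
Qed.

Fact uone_neq0 : uconst 1 != 0.
Proof.
by apply/eqP => /uclassP/ucounit_ueq/= /eqP; rewrite oner_eq0.
Qed.

HB.instance Definition _ := GRing.Zmodule_isNzRing.Build U
  umulA umul1 umulr1 umulDl umulDr uone_neq0.

Definition uscale (a : K) (x : U) : U := uconst a * x.

Fact uscaleA a b x : uscale a (uscale b x) = uscale (a * b) x.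
Proof. by rewrite /uscale uconstM; exact: umulA. Qed.
Fact uscale1 : left_id 1 uscale. Proof. exact: umul1. Qed.
Fact uscaleDr : right_distributive uscale +%R.
Proof. by move=> a x y; exact: mulrDr. Qed.
Fact uscaleDl x : {morph uscale^~ x : a b / a + b}.
Proof. by move=> a b; rewrite /uscale -mulrDl uconstD. Qed.

HB.instance Definition _ := GRing.Zmodule_isLmodule.Build K U
  uscaleA uscale1 uscaleDr uscaleDl.

Fact uscaleAl (a : K) (x y : U) : a *: (x * y) = (a *: x) * y.
Proof. exact: mulrA. Qed.
HB.instance Definition _ := GRing.Lmodule_isLalgebra.Build K U uscaleAl.

Fact uscaleAr (a : K) (x y : U) : a *: (x * y) = x * (a *: y).
Proof.
rewrite -[a *: y]/(uconst a * y) -[uconst a * y]/(umul (uconst a) y) uconstC.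
by rewrite -[LHS]/(umul (uconst a) (x * y)) uconstC; exact/esym/mulrA.
Qed.
HB.instance Definition _ := GRing.Lalgebra_isAlgebra.Build K U uscaleAr.

Definition pgen (s : bool) : U := uclass (UP s).
Definition kappa : U := uclass UKappa.

Lemma pgen_comm : pgen true * pgen false = pgen false * pgen true.
Proof.
by rewrite -[LHS]/(umul _ _) -[RHS]/(umul _ _) !umulE; apply/uclassP/ueq_pp.
Qed.

Lemma pgen_kappa s : pgen s * kappa = q ^ (- pm s) *: (kappa * pgen s).
Proof.
rewrite -[LHS]/(umul _ _) -[RHS]/(umul (uconst _) (umul _ _)).
rewrite [umul kappa _]umulE [RHS]umulE [LHS]umulE.
by apply/uclassP/ueq_pkappa.
Qed.

Lemma kappa_exp : kappa ^+ p = 1.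
Proof.
transitivity (uclass (uexp UKappa p)); last by apply/uclassP/ueq_kappap.
elim: p => //= n IH; rewrite exprS IH -[LHS]/(umul _ _); exact: umulE.
Qed.

(* kappa^-1, by kappa^p = 1. *)
Definition kappaV : U := kappa ^+ p.-1.

Lemma kappaVK : (0 < p)%N -> kappaV * kappa = 1 /\ kappa * kappaV = 1.
Proof.
by move=> p0; rewrite /kappaV -exprSr -exprS prednK // kappa_exp.
Qed.

End Uqe11.

Section RightRepresentation.
Variables (R : realType) (p : nat) (q qhalf : R[i]).
Local Notation A := (qplane (smoothFun R) p q).
Local Notation U := (Uqe11 p q).
Local Notation eta := (eta (smoothFun R) p q).
Local Notation p_ := (pgen p q).
Local Notation kappa := (kappa p q).
Local Notation kappaV := (kappaV p q).

(* [rho] is the right representation of U_q(e(1,1)); [qhalf] is q^(1/2), and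
   [qhalf ^ pm s] is q^(+-1/2).  At k = 0 the factor [qnum q 0] = 0 makes the
   exponent [k.-1] irrelevant. *)
Record right_rep (rho : U -> A -> A) : Prop := RightRep {
  right_rep_linear u : linear (rho u);
  right_rep_linearU Y : linear (rho^~ Y);
  right_rep1 Y : rho 1 Y = Y;
  right_repM u v Y : rho (u * v) Y = rho v (rho u Y);
  right_rep_p_eta s k :
    rho (p_ s) (eta s ^+ k) = ('i%C * qhalf ^ pm s * qnum q k) *: eta s ^+ k.-1;
  right_rep_p_etaN s k : rho (p_ s) (eta (~~ s) ^+ k) = 0;
  right_rep_kappa_eta s k :
    rho kappa (eta s ^+ k) = q ^ (pm s * k) *: eta s ^+ k;
  right_rep_p_fun s f :
    rho (p_ s) (qplane_fun p q f) =
      ('i%C * qhalf ^ pm s * ((-1) ^+ (p.+1)./2 / qfact q p.-1)) *: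
      (eta s ^+ p.-1 * qplane_fun p q (pderiv s f));
  right_rep_pp_fun s f :
    rho (p_ s ^+ p) (qplane_fun p q f) = 'i%C *: qplane_fun p q (pderiv s f);
  right_rep_kappa_fun f : rho kappa (qplane_fun p q f) = qplane_fun p q f;
  right_rep_pM s X Y :
    rho (p_ s) (X * Y) = rho (p_ s) X * rho kappa Y + rho kappaV X * rho (p_ s) Y;
  right_rep_kappaM X Y : rho kappa (X * Y) = rho kappa X * rho kappa Y
}.

(* p_+' = q^(-1/2) p_+ kappa^-1 and p_-' = q^(-1/2) p_- kappa. *)
Definition pgen' (s : bool) : U :=
  qhalf^-1 *: (p_ s * (if s then kappaV else kappa)).

End RightRepresentation.

(* Main.v *)
(* On the basis eta_+^a eta_-^b the operator R(p_s') lowers the exponent of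
   eta_s by one, multiplying by a nonzero scalar; at exponent 0 it differentiates
   the coefficient along z_s and wraps around to exponent p - 1.  Hence each
   eigenvalue equation is a cyclic first-order recursion for the coefficients:
   its steps below p - 1 express every coefficient through that of
   eta_+^0 eta_-^0 and produce the cut-off q-exponential, while the wrap-around
   step is the differential equation d f / d z_s = i chi_s^p f for that remaining
   coefficient. *)

Require Import Defs.
From mathcomp Require Import all_boot all_order all_algebra.
From mathcomp Require Import all_classical all_reals all_analysis.
From mathcomp.real_closed Require Import complex.
From mathcomp Require Import ring.

Import Order.TTheory GRing.Theory Num.Theory.
Import numFieldNormedType.Exports.
Local Open Scope ring_scope.

Set Implicit Arguments.
Unset Strict Implicit.
Unset Printing Implicit Defensive.

(** * Partial derivatives and exponentials in the algebra of smooth functions *)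

Section SmoothFunctions.
Variable R : realType.
Implicit Types (f g : smoothFun R) (s : bool) (w : R[i]) (z : R * R).

Lemma smooth_derivable s f z :
  derivable (fun t => complex.Re (f t)) z (axis R s) /\
  derivable (fun t => complex.Im (f t)) z (axis R s).
Proof.
have /smooth_predP/(_ 1%N) [[_ /(_ s)[hr _]] [_ /(_ s)[hi _]]] := smooth_valP f.
by split.
Qed.

Lemma pderivM s f g : pderiv s (f * g) = pderiv s f * g + f * pderiv s g.
Proof.
apply: val_inj; apply/funext => z.
have [fr fi] := smooth_derivable s f z; have [gr gi] := smooth_derivable s g z.
have Er : (fun t => complex.Re ((f * g) t)) =
    (fun t => complex.Re (f t)) * (fun t => complex.Re (g t)) -
    (fun t => complex.Im (f t)) * (fun t => complex.Im (g t)).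
  apply/funext => t; rewrite -[(f * g) t]/(f t * g t) !fctE.
  by case: (f t) (g t) => [? ?] [? ?].
have Ei : (fun t => complex.Im ((f * g) t)) =
    (fun t => complex.Re (f t)) * (fun t => complex.Im (g t)) +
    (fun t => complex.Im (f t)) * (fun t => complex.Re (g t)).
  apply/funext => t; rewrite -[(f * g) t]/(f t * g t) !fctE.
  by case: (f t) (g t) => [? ?] [? ?].
rewrite -[LHS]/(pderiv_fun s (f * g) z).
rewrite -[RHS]/(pderiv_fun s f z * g z + f z * pderiv_fun s g z).
have dr := deriveB (derivableM fr gr) (derivableM fi gi).
have di := deriveD (derivableM fr gi) (derivableM fi gr).
rewrite (deriveM fr gr) (deriveM fi gi) in dr.
rewrite (deriveM fr gi) (deriveM fi gr) in di.
rewrite /pderiv_fun Er Ei dr di.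
move: ('D_(axis R s) (fun t => complex.Re (f t)) z) => fr'.
move: ('D_(axis R s) (fun t => complex.Im (f t)) z) => fi'.
move: ('D_(axis R s) (fun t => complex.Re (g t)) z) => gr'.
move: ('D_(axis R s) (fun t => complex.Im (g t)) z) => gi'.
case: (f z) (g z) => [a b] [c d] {Er Ei dr di fr fi gr gi}.
by apply/eqP; rewrite eq_complex /= /GRing.scale /=; apply/andP; split;
  apply/eqP; ring.
Qed.

Lemma pderiv_cst s w : pderiv s (w%:A : smoothFun R) = 0.
Proof.
apply: val_inj; apply/funext => z.
rewrite -[LHS]/(pderiv_fun s (w%:A : smoothFun R) z).
have -> : ((w%:A : smoothFun R) : R * R -> R[i]) = fun=> w.
  by apply/funext => t; exact: mulr1.
by rewrite /pderiv_fun !derive_cst.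
Qed.

Lemma pderivZ s w f : pderiv s (w *: f) = w *: pderiv s f.
Proof.
by rewrite -[w *: f]mulr_algl pderivM pderiv_cst mul0r add0r mulr_algl.
Qed.

(** For w = a + ib the real and imaginary parts are e^(at) cos(bt) and e^(at) sin(bt) in the single
    coordinate t = z_s'. [is_derive_coordinate] therefore reduces the derivative along the axis of
    s' to one variable and makes the other one vanish. *)
Lemma pderiv_expwave s s' w :
  pderiv s (expwave s' w) = if s' == s then w *: expwave s' w else 0.
Proof.
apply: val_inj; apply/funext => z.
case: w => a b.
have lin (k x : R) : is_derive x (1 : R) (fun t : R => k * t) k.
  by apply: is_derive_eq; rewrite /GRing.scale /= mulr1.
set x := coordinate s' z.
have he : is_derive x (1 : R) (fun t : R => expR (a * t)) (a * expR (a * x)).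
  by rewrite mulrC; apply: (@is_derive1_comp _ expR (fun t : R => a * t)).
have hc : is_derive x (1 : R) (fun t : R => cos (b * t)) (b * - sin (b * x)).
  by rewrite mulrC; apply: (@is_derive1_comp _ (@cos R) (fun t : R => b * t)).
have hs : is_derive x (1 : R) (fun t : R => sin (b * t)) (b * cos (b * x)).
  by rewrite mulrC; apply: (@is_derive1_comp _ (@sin R) (fun t : R => b * t)).
have [_ dr] := is_derive_coordinate s (is_deriveM he hc).
have [_ di] := is_derive_coordinate s (is_deriveM he hs).
rewrite -[LHS]/(pderiv_fun s (expwave s' (a +i* b)%C) z) /pderiv_fun.
have -> : (fun t => complex.Re (expwave s' (a +i* b)%C t)) =
    (fun t => ((fun t : R => expR (a * t)) * (fun t : R => cos (b * t)))
                (coordinate s' t)).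
  by apply/funext => t /=; rewrite !mulr0 subr0 add0r.
have -> : (fun t => complex.Im (expwave s' (a +i* b)%C t)) =
    (fun t => ((fun t : R => expR (a * t)) * (fun t : R => sin (b * t)))
                (coordinate s' t)).
  by apply/funext => t /=; rewrite !mulr0 subr0 add0r.
rewrite dr di; case: (s' == s); last by [].
rewrite -[RHS]/((a +i* b)%C * cexp ((a +i* b)%C * (coordinate s' z)%:C%C)).
apply/eqP; rewrite eq_complex /= /GRing.scale /= -/x !mulr0 subr0 add0r.
by apply/andP; split; apply/eqP; ring.
Qed.

(** Exponentials are units: this allows an eigenfunction to be divided by them, and shows that a
    product of them is nonzero. *)
Lemma expwaveN s w : expwave s w * expwave s (- w) = 1 :> smoothFun R.
Proof.
apply: val_inj; apply/funext => z; case: w => a b.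
rewrite -[LHS]/(cexp ((a +i* b)%C * (coordinate s z)%:C%C) *
  cexp ((- (a +i* b)%C) * (coordinate s z)%:C%C)).
rewrite -[RHS]/(1 : R[i]); set x := coordinate s z.
apply/eqP; rewrite eq_complex /= /cexp /= !mulr0 !subr0 !add0r !mulNr.
rewrite expRN cosN sinN; apply/andP; split; apply/eqP; last by ring.
rewrite -[RHS](cos2Dsin2 (b * x)).
have e0 : expR (a * x) != 0 by rewrite gt_eqF // expR_gt0.
by field.
Qed.

(** Every point is reached from the origin by one move along each axis, and on each axis-parallel
    line u restricts to a one-variable function with zero derivative. *)
Lemma derive_axis_eq0_cst (u : R * R -> R) :
    (forall s z, is_derive z (axis R s) u 0) -> forall z, u z = u (0, 0).
Proof.
move=> hu.
have line s z (t : R) : u (z + t *: axis R s) = u z.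
  pose h (k : R) := u (z + k *: axis R s).
  have hd (x : R) : is_derive x (1 : R) h 0.
    have [dr vl] := hu s (z + x *: axis R s).
    have E : (fun k : R => k^-1 *: ((h \o shift x) (k *: (1 : R)) - h x)) =
        (fun k : R => k^-1 *: ((u \o shift (z + x *: axis R s)) (k *: axis R s)
           - u (z + x *: axis R s))).
      apply/funext => k; rewrite /h /shift /=.
      by rewrite [k *: 1]mulr1 scalerDl addrCA.
    by split; [rewrite /derivable E|rewrite /derive E].
  by have := is_derive_0_is_cst t 0 hd; rewrite /h scale0r addr0.
move=> [x y].
have -> : (x, y) = (0, 0) + x *: axis R true + y *: axis R false :> R * R.
  congr pair; rewrite /= /GRing.scale /=; ring.
by rewrite !line.
Qed.

Lemma pderiv_eq0_cst f : (forall s, pderiv s f = 0) -> exists w, f = w%:A.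
Proof.
move=> f0; exists (f (0, 0)); apply: val_inj; apply/funext => z.
have d s t : pderiv_fun s f t = 0.
  exact: (congr1 (fun g => smooth_val g t) (f0 s)).
have hr : complex.Re (f z) = complex.Re (f (0, 0)).
  apply: (@derive_axis_eq0_cst (fun t => complex.Re (f t)) _ z) => s t.
  have [dr _] := smooth_derivable s f t; split=> //.
  by have := d s t => /(congr1 (@complex.Re R)).
have hi : complex.Im (f z) = complex.Im (f (0, 0)).
  apply: (@derive_axis_eq0_cst (fun t => complex.Im (f t)) _ z) => s t.
  have [_ di] := smooth_derivable s f t; split=> //.
  by have := d s t => /(congr1 (@complex.Im R)).
rewrite -[RHS]/(f (0, 0) * 1) mulr1.
by apply/eqP; rewrite eq_complex hr hi !eqxx.
Qed.

Lemma pderiv_eigen (w : bool -> R[i]) f :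
  (forall s, pderiv s f = w s *: f) <->
  exists c, f = c *: (expwave true (w true) * expwave false (w false)).
Proof.
split=> [hf|[c ->] s]; last first.
  rewrite pderivZ pderivM !pderiv_expwave scalerA [w s * c]mulrC -scalerA.
  by congr (_ *: _); case: s;
    rewrite /= ?mul0r ?mulr0 ?addr0 ?add0r -?scalerAl -?scalerAr.
(* f times the inverse of the plane wave is annihilated by both derivatives. *)
pose g := f * (expwave true (- w true) * expwave false (- w false)).
have [|c hc] := @pderiv_eq0_cst g.
  move=> s; rewrite /g !pderivM !pderiv_expwave hf.
  case: s; rewrite /= ?mul0r ?mulr0 ?addr0 ?add0r -?scalerAl -?scalerAr;
  by rewrite scaleNr subrr.
(* Here f is written as f * (1 * 1), and each 1 is expanded as an exponential times its inverse; the
   inverses together with f form g, which is the constant c. *)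
exists c; rewrite -[f]mulr1 -[in LHS](mulr1 1).
rewrite -{1}(expwaveN true (w true)) -(expwaveN false (w false)).
rewrite -[RHS]mulr_algl -hc /g; ring.
Qed.

End SmoothFunctions.

(** * Nonvanishing of q-numbers and the coefficients of the cut-off q-exponential *)

Section QNumbers.
Variables (K : fieldType) (q : K).

Definition qexp_coef (m : nat) : K := q ^+ (m * m.-1)./2 / qfact q m.

Lemma qexp_coef0 : qexp_coef 0 = 1.
Proof. by rewrite /qexp_coef /qfact big_geq // expr0 divr1. Qed.

Variables (p : nat) (p_odd : odd p) (p_gt2 : (2 < p)%N).
Hypothesis q_prim : p.-primitive_root q.

Lemma primitive_root_neq0 : q != 0.
Proof.
apply/eqP => q0; move: (prim_expr_order q_prim).
rewrite q0 expr0n gtn_eqF ?(prim_order_gt0 q_prim) // => /esym/eqP.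
by rewrite oner_eq0.
Qed.

(** A zero numerator would give q^(2k) = 1, so p divides 2k; as p is odd it would divide k, which is
    impossible for 0 < k < p. *)
Lemma qnum_neq0 k : (0 < k < p)%N -> qnum q k != 0.
Proof.
have q0 := primitive_root_neq0.
have sub j : (0 < j < p)%N -> q ^+ j - q ^- j != 0.
  move=> /andP[j0 jp]; rewrite subr_eq0; apply/eqP => E.
  have : q ^+ (2 * j) == 1 by rewrite mul2n -addnn exprD {1}E mulVf ?expf_neq0.
  rewrite -(prim_order_dvd q_prim) Gauss_dvdr ?coprimen2 //.
  by move=> /(dvdn_leq j0); rewrite leqNgt jp.
move=> hk; rewrite mulf_neq0 ?sub // invr_neq0 //.
(* The denominator q - q^-1 is the case j = 1 of [sub]. *)
by have := sub 1%N; rewrite !expr1; apply; rewrite (ltn_trans _ p_gt2).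
Qed.

Lemma qfact_neq0 k : (k < p)%N -> qfact q k != 0.
Proof.
move=> kp; rewrite /qfact prodf_seq_neq0; apply/allP => i /=.
rewrite mem_index_iota => /andP[i0 ik]; apply: qnum_neq0.
by rewrite i0 (leq_ltn_trans _ kp).
Qed.

(** The factor [k+1] / q^k is the one in [lower]: this recursion is what makes the q-exponential
    solve the eigenvalue equation. It rests on C(k+1, 2) = C(k, 2) + k. *)
Lemma qexp_coefS k : (k.+1 < p)%N ->
  qnum q k.+1 / q ^+ k * qexp_coef k.+1 = qexp_coef k.
Proof.
move=> kp; have q0 := primitive_root_neq0.
rewrite /qexp_coef [qfact q k.+1]/qfact big_nat_recr //= -/(qfact q k).
have -> : ((k.+1 * k)./2 = k + (k * k.-1)./2)%N.
  by rewrite -(bin2 k) -(bin2 k.+1) binS bin1 addnC.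
have := @qnum_neq0 k.+1 kp; have := qfact_neq0 (ltnW kp).
rewrite exprD; have : q ^+ k != 0 by rewrite expf_neq0.
move: (q ^+ k) (qnum _ _) (qfact _ _) => x y z x0 z0 y0; field.
by rewrite x0 y0 z0.
Qed.

(** With p = 2h + 1, (p-1)(p-2)/2 = (h-1)p + 1, so the power of q reduces to q itself. This value
    enters the wrap-around step. *)
Lemma qexp_coef_last : qexp_coef p.-1 = q / qfact q p.-1.
Proof.
rewrite /qexp_coef; congr (_ / _).
have E := odd_double_half p; rewrite p_odd in E; set h := p./2 in E.
have h0 : (0 < h)%N by rewrite half_gt0 ltnW.
have -> : ((p.-1 * p.-2)./2 = h.-1 * p + 1)%N.
  by rewrite -E; case: h h0 {E} => // h _; rewrite -[RHS]doubleK; congr half;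
    rewrite add1n doubleS /= -!muln2; ring.
by rewrite exprD expr1 mulnC exprM (prim_expr_order q_prim) expr1n mul1r.
Qed.

End QNumbers.

(** * Normal-ordered monomials and the product of two q-exponentials *)

Section QuantumPlane.
Variables (K : fieldType) (S : comAlgType K) (p : nat) (q : K).
Local Notation A := (qplane S p q).
Local Notation idx := ('I_p * 'I_p)%type.
Local Notation mono := (mono p q).
Local Notation eta := (eta S p q).

Lemma sum_monoE (F : idx -> S) m :
  (\sum_(i : idx) mono i.1 i.2 (F i) : A) m = F m.
Proof.
pose X : A := [ffun i => F i].
rewrite -[RHS](ffunE F m) -[RHS]/(X m) [X in RHS]qplaneE.
by congr (fun_of_fin _ m); apply: eq_bigr => i _; rewrite ffunE.
Qed.

Lemma mono_eta a b f : mono a b f = eta true ^+ a * mono 0 b f :> A.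
Proof. by rewrite eta_exp mono_mul !muln0 expr0 scale1r mul1r !addn0. Qed.

Lemma mono0_eta b f : mono 0 b f = eta false ^+ b * qplane_fun p q f :> A.
Proof. by rewrite eta_exp mono_mul !muln0 expr0 scale1r mul1r !addn0. Qed.

Lemma qplane_exprZn (c : K) (X : A) n : (c *: X) ^+ n = c ^+ n *: X ^+ n.
Proof.
elim: n => [|n IH]; first by rewrite !expr0 scale1r.
by rewrite !exprS IH -qplane_scalerAl -qplane_scalerAr scalerA.
Qed.

(** The factors already stand in normal order, eta_+ before eta_- before functions, so expanding the
    product creates no commutation powers of q. *)
Lemma qexp_mulE (c d : K) (f g : S) :
  qexp (c *: eta true) * qexp (d *: eta false) *
    qplane_fun p q f * qplane_fun p q g =
  \sum_(m : idx) mono m.1 m.2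
    (((qexp_coef q m.1 * c ^+ m.1) * (qexp_coef q m.2 * d ^+ m.2)) *: (f * g)) :> A.
Proof.
rewrite -mulrA -qplane_funM /qexp big_distrlr /= pair_bigA mulr_suml /=.
apply: eq_bigr => m _; rewrite !qplane_exprZn !scalerA.
rewrite -!(qplane_scalerAl, qplane_scalerAr) scalerA linearZ /=; congr (_ *: _).
by rewrite [RHS]mono_eta [mono 0 m.2 _]mono0_eta mulrA.
Qed.

End QuantumPlane.

(** * The operators R(p_s') on monomials *)

Section RightRepresentation.
Variables (R : realType) (p : nat) (q qhalf : R[i]).
Local Notation S := (smoothFun R).
Local Notation A := (qplane S p q).
Local Notation idx := ('I_p * 'I_p)%type.
Local Notation mono := (mono p q).
Local Notation eta := (eta S p q).
Local Notation p_ := (pgen p q).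
Local Notation kappa := (kappa p q).
Local Notation kappaV := (kappaV p q).
Variable rho : Uqe11 p q -> A -> A.
Hypotheses (p_odd : odd p) (p_gt2 : (2 < p)%N) (q_prim : p.-primitive_root q).
Hypotheses (qhalfE : qhalf ^+ 2 = q) (rhoP : right_rep qhalf rho).

Let p_gt0 : (0 < p)%N := ltnW (ltnW p_gt2).
Let q_neq0 : q != 0 := primitive_root_neq0 q_prim.

Let q_exp_pred : q ^+ p.-1 = q^-1.
Proof.
apply: (mulfI q_neq0); rewrite -exprS prednK // (prim_expr_order q_prim).
by rewrite mulfV.
Qed.

Let qhalf_neq0 : qhalf != 0.
Proof. by move: q_neq0; rewrite -qhalfE expf_eq0. Qed.

Lemma rhoZ u c Y : rho u (c *: Y) = c *: rho u Y.
Proof. exact: (GRing.scalable_linear (right_rep_linear rhoP u)). Qed.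

Lemma rhoZl u c Y : rho (c *: u) Y = c *: rho u Y.
Proof. exact: (GRing.scalable_linear (right_rep_linearU rhoP Y)). Qed.

Lemma rho_sum u (I : finType) (F : I -> A) :
  rho u (\sum_i F i) = \sum_i rho u (F i).
Proof.
apply: (big_morph (rho u)) => [X Y|].
  by have := right_rep_linear rhoP u 1 X Y; rewrite !scale1r.
by rewrite -(scale0r 0) rhoZ !scale0r.
Qed.

Lemma rho_kappa_mono a b f :
  rho kappa (mono a b f) = (q ^+ a / q ^+ b) *: mono a b f.
Proof.
rewrite mono_eta mono0_eta !(right_rep_kappaM rhoP) !(right_rep_kappa_eta rhoP).
rewrite (right_rep_kappa_fun rhoP) /= mul1r mulN1r -exprnN -exprnP.
by rewrite -!(qplane_scalerAl, qplane_scalerAr) scalerA.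
Qed.

Lemma rho_kappaV_mono a b f :
  rho kappaV (mono a b f) = (q ^+ b / q ^+ a) *: mono a b f.
Proof.
have : rho kappaV (rho kappa (mono a b f)) = mono a b f.
  by rewrite -(right_repM rhoP) (kappaVK q p_gt0).2 (right_rep1 rhoP).
rewrite rho_kappa_mono rhoZ => {2}<-; rewrite scalerA.
have qa : q ^+ a != 0 by rewrite expf_neq0.
have qb : q ^+ b != 0 by rewrite expf_neq0.
suff -> : q ^+ b / q ^+ a * (q ^+ a / q ^+ b) = 1 by rewrite scale1r.
by field; rewrite qa qb.
Qed.

(* The scalar (-1)^((p+1)/2) / [p-1]! in R(p_s) f. *)
Definition pderiv_coef : R[i] := (-1) ^+ (p.+1)./2 / qfact q p.-1.

(** Twisted Leibniz rule on eta_+^a (eta_-^b f). For a = 0, kappa^-1 scales eta_-^b by q^b, and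
    moving eta_-^b past eta_+^(p-1) costs q^(2b(p-1)) = q^(-2b), leaving q^(-b). For a > 0 the term
    differentiating f contains eta_+^(a+p-1) = 0. *)
Lemma rho_p_true_mono a b f :
  rho (p_ true) (mono a b f) = ('i%C * qhalf / q ^+ b) *:
    (if a is a'.+1 then qnum q a *: mono a' b f
     else pderiv_coef *: mono p.-1 b (pderiv true f)).
Proof.
have qb : q ^+ b != 0 by rewrite expf_neq0.
have P0 : rho (p_ true) (mono 0 b f) =
    ('i%C * qhalf / q ^+ b * pderiv_coef) *: mono p.-1 b (pderiv true f).
  rewrite {1}mono0_eta (right_rep_pM rhoP) (right_rep_p_etaN rhoP true) mul0r add0r.
  rewrite (right_rep_p_fun rhoP) !eta_exp /= rho_kappaV_mono.
  rewrite expr0 divr1 -!(qplane_scalerAl, qplane_scalerAr) scalerA !mono_mul.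
  rewrite !mul0n !muln0 expr0 scale1r !mul1r !add0n !addn0 linearZ /= scalerA.
  congr (_ *: _); rewrite -/pderiv_coef.
  have -> : (2 * (b * p.-1) = p.-1 * (b * 2))%N by ring.
  rewrite [q ^+ (p.-1 * _)]exprM q_exp_pred exprVn exprM expr2 /=.
  by field.
case: a => [|a]; first by rewrite P0 scalerA.
rewrite mono_eta (right_rep_pM rhoP) P0 (right_rep_p_eta rhoP).
rewrite [X in _ + X](_ : _ = 0) ?addr0; last first.
  rewrite eta_exp rho_kappaV_mono -!(qplane_scalerAl, qplane_scalerAr) mono_mul.
  by rewrite mono_ge ?scaler0 // addSnnS prednK // leq_addl.
rewrite rho_kappa_mono -!(qplane_scalerAl, qplane_scalerAr) !scalerA -mono_eta.
by congr (_ *: _); rewrite expr0 div1r; ring.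
Qed.

Lemma rho_p_false_mono a b f :
  rho (p_ false) (mono a b f) = ('i%C / qhalf / q ^+ a) *:
    (if b is b'.+1 then qnum q b *: mono a b' f
     else pderiv_coef *: mono a p.-1 (pderiv false f)).
Proof.
have P0 : rho (p_ false) (mono 0 b f) = ('i%C / qhalf) *:
    (if b is b'.+1 then qnum q b *: mono 0 b' f
     else pderiv_coef *: mono 0 p.-1 (pderiv false f)).
  case: b => [|b].
    rewrite -[mono 0 0 f]/(qplane_fun p q f) (right_rep_p_fun rhoP) scalerA.
    by rewrite -mono0_eta.
  rewrite mono0_eta (right_rep_pM rhoP) (right_rep_p_eta rhoP).
  rewrite (right_rep_kappa_fun rhoP) (right_rep_p_fun rhoP).
  rewrite [X in _ + X](_ : _ = 0) ?addr0; last first.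
    rewrite !eta_exp rho_kappaV_mono -!(qplane_scalerAl, qplane_scalerAr).
    rewrite !mono_mul mono_ge ?scaler0 //.
    by rewrite !addn0 addSnnS prednK // leq_addl orbT.
  by rewrite -qplane_scalerAl -mono0_eta scalerA.
rewrite mono_eta (right_rep_pM rhoP) (right_rep_p_etaN rhoP false) mul0r add0r P0.
rewrite eta_exp rho_kappaV_mono expr0 -!(qplane_scalerAl, qplane_scalerAr).
rewrite scalerA; congr (_ *: _); first by ring.
case: b {P0} => [|b]; rewrite -qplane_scalerAr mono_mul mul0n muln0 expr0;
  by rewrite scale1r mul1r addn0.
Qed.

(* [R(p_s')] sends eta_s^k f to eta_s^(k-1) (lower s k f), with k - 1 read
   modulo p. *)
Definition lower s (k : nat) (f : S) : S := ('i%C / (if s then 1 else q)) *: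
  (if k is k'.+1 then (qnum q k / q ^+ k') *: f
   else (pderiv_coef * q) *: pderiv s f).

(** Since R reverses products, kappa^-1 acts after p_+. Its factor q^b cancels the q^(-b) of
    [rho_p_true_mono], so the scalar no longer depends on b and the two eigenvalue equations
    decouple. At a = 0 the remaining q^-(p-1) is the factor q in [lower]. *)
Lemma rho_pgen'_true_mono a b f :
  rho (pgen' p q qhalf true) (mono a b f) =
  mono (if a is a'.+1 then a' else p.-1) b (lower true a f).
Proof.
have qb : q ^+ b != 0 by rewrite expf_neq0.
rewrite /pgen' rhoZl (right_repM rhoP) rho_p_true_mono rhoZ /lower divr1.
case: a => [|a]; rewrite rhoZ rho_kappaV_mono !scalerA linearZ /=;
  last first.
  have qa : q ^+ a != 0 by rewrite expf_neq0.
  by congr (_ *: _); field; rewrite qa qb qhalf_neq0.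
congr (_ *: _).
rewrite q_exp_pred invrK.
by field; rewrite qb qhalf_neq0.
Qed.

(** Here kappa cancels the q^(-a). The two factors q^(-1/2), one from p_-' and one from R(p_-),
    combine into the 1/q of [lower false]. *)
Lemma rho_pgen'_false_mono a b f :
  rho (pgen' p q qhalf false) (mono a b f) =
  mono a (if b is b'.+1 then b' else p.-1) (lower false b f).
Proof.
have qa : q ^+ a != 0 by rewrite expf_neq0.
have qV : q^-1 = qhalf^-1 * qhalf^-1 by rewrite -qhalfE expr2 invfM.
rewrite /pgen' rhoZl (right_repM rhoP) rho_p_false_mono rhoZ /lower.
case: b => [|b]; rewrite rhoZ rho_kappa_mono !scalerA linearZ /=;
  last first.
  have qb : q ^+ b != 0 by rewrite expf_neq0.
  rewrite qV.
  by congr (_ *: _); field; rewrite qa qb qhalf_neq0.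
congr (_ *: _).
rewrite q_exp_pred invrK qV.
by field; rewrite qa qhalf_neq0.
Qed.

(** * The eigenvalue equations coefficient by coefficient *)

Lemma ord_predE (k : 'I_p) :
  ord_pred k = (if k : nat is k'.+1 then k' else p.-1) :> nat.
Proof.
case: k => [[|k] kp] /=; first by rewrite add0n modn_small // prednK.
by rewrite modnDr modn_small // ltnW.
Qed.

(** Lowering is a cyclic permutation of the monomials up to the action on coefficients, so exactly
    one term of the expansion of Y reaches (a, b); reindexing by the cyclic successor isolates
    it. *)
Lemma rho_pgen'_trueE Y (a b : 'I_p) :
  rho (pgen' p q qhalf true) Y (a, b) = lower true (ordS a) (Y (ordS a, b)).
Proof.
pose sh (m : idx) : idx := (ordS m.1, m.2).
have sh_bij : bijective sh.
  by exists (fun m => (ord_pred m.1, m.2)) => -[x y];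
    rewrite /sh /= (ordSK, ord_predK).
rewrite [in LHS](qplaneE Y) rho_sum (reindex sh); last exact: onW_bij.
rewrite (eq_bigr (fun m : idx => mono m.1 m.2 (lower true (sh m).1 (Y (sh m))))).
  by rewrite sum_monoE.
by move=> m _; rewrite rho_pgen'_true_mono -ord_predE ordSK.
Qed.

Lemma rho_pgen'_falseE Y (a b : 'I_p) :
  rho (pgen' p q qhalf false) Y (a, b) = lower false (ordS b) (Y (a, ordS b)).
Proof.
pose sh (m : idx) : idx := (m.1, ordS m.2).
have sh_bij : bijective sh.
  by exists (fun m => (m.1, ord_pred m.2)) => -[x y];
    rewrite /sh /= (ordSK, ord_predK).
rewrite [in LHS](qplaneE Y) rho_sum (reindex sh); last exact: onW_bij.
rewrite (eq_bigr (fun m : idx => mono m.1 m.2 (lower false (sh m).2 (Y (sh m))))).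
  by rewrite sum_monoE.
by move=> m _; rewrite rho_pgen'_false_mono -ord_predE ordSK.
Qed.

(* The coefficient of eta_s^k in the q-exponential factor of index s. *)
Definition eigen_coef s (chi : R[i]) (k : nat) : R[i] :=
  qexp_coef q k * ((if s then - 'i%C else - 'i%C * q) * chi) ^+ k.

Lemma eigen_coef0 s chi : eigen_coef s chi 0 = 1.
Proof. by rewrite /eigen_coef qexp_coef0 expr0 mulr1. Qed.

Let sqr_i : 'i%C * 'i%C = -1 :> R[i].
Proof. by rewrite -expr2 sqr_i. Qed.

(** The base mu, -i chi_+ or -iq chi_-, is the number with (i / l) mu = chi, where l is 1 or q
    according to s; the rest is [qexp_coefS]. *)
Lemma lower_eigen_coefS s chi k : (k.+1 < p)%N ->
  'i%C / (if s then 1 else q) * (qnum q k.+1 / q ^+ k) * eigen_coef s chi k.+1 =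
  chi * eigen_coef s chi k.
Proof.
move=> kp; rewrite /eigen_coef exprS.
set mu := (if s then - _ else _) * chi; rewrite -(qexp_coefS p_odd p_gt2 q_prim kp).
suff E : 'i%C / (if s then 1 else q) * mu = chi.
  by rewrite -[X in _ = X * _]E; ring.
rewrite /mu; case: s @mu => mu; first by rewrite divr1 mulrA mulrN sqr_i opprK mul1r.
have -> : 'i%C / q * (- 'i%C * q * chi) = - ('i%C * 'i%C) * (chi * (q / q)) by ring.
by rewrite sqr_i opprK mul1r mulfV // mulr1.
Qed.

(** Matches the scalars of the wrap-around step. With p - 1 = 2h, (-i)^(p-1) = (-1)^h; the extra
    sign in (-1)^((p+1)/2) = -(-1)^h is absorbed by i * i; for index - the power q^(p-1) = q^-1
    supplies the remaining 1/q. *)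
Lemma eigen_coef_last s chi :
  chi * eigen_coef s chi p.-1 =
  'i%C / (if s then 1 else q) * (pderiv_coef * q) * ('i%C * chi ^+ p).
Proof.
have pE : p.-1 = (p./2).*2 by rewrite -{1}(odd_double_half p) p_odd.
have pS : (p.+1)./2 = (p./2).+1.
  by rewrite -{1}(odd_double_half p) p_odd add1n -doubleS doubleK.
rewrite /eigen_coef (qexp_coef_last p_odd p_gt2 q_prim) /pderiv_coef pS.
have -> : chi ^+ p = chi * chi ^+ p.-1 by rewrite -exprS prednK.
rewrite exprMn.
have -> : (if s then - 'i%C else - 'i%C * q) ^+ p.-1 =
    (-1) ^+ p./2 / (if s then 1 else q) :> R[i].
  have iE : (- 'i%C) ^+ p.-1 = (-1) ^+ p./2 :> R[i].
    by rewrite pE -mul2n exprM expr2 mulrNN sqr_i.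
  case: s; rewrite ?divr1 // exprMn iE; congr (_ * _).
  exact: q_exp_pred.
rewrite exprS; move: ((-1) ^+ p./2) (chi ^+ p.-1) => e x.
set l := (if s then 1 else q).
transitivity (- ('i%C * 'i%C) * (chi * (q / qfact q p.-1 * (e / l * x)))).
  by rewrite sqr_i opprK mul1r; ring.
ring.
Qed.

(** Every scalar introduced by [lower] is nonzero, so each step of the recursion can be solved for
    the next coefficient and the last one for the derivative. Nothing is divided by chi, so chi = 0
    is covered. *)
Lemma lower_eigenP s chi (o : 'I_p) (y : 'I_p -> S) : o = 0%N :> nat ->
  (forall k, lower s (ordS k) (y (ordS k)) = chi *: y k) <->
  (forall k : 'I_p, y k = eigen_coef s chi k *: y o) /\
  pderiv s (y o) = ('i%C * chi ^+ p) *: y o.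
Proof.
move=> o0.
have lam0 : 'i%C / (if s then 1 else q) != 0 :> R[i].
  rewrite mulf_neq0 ?invr_neq0 //; last by case: s; rewrite ?oner_neq0.
  by apply/eqP => i0; move/eqP: sqr_i; rewrite i0 mul0r eq_sym oppr_eq0 oner_eq0.
have pd0 : pderiv_coef != 0.
  rewrite mulf_neq0 ?signr_eq0 // invr_neq0 // (qfact_neq0 p_odd p_gt2 q_prim) //.
  by rewrite prednK.
have ordSE (k : 'I_p) (kp : (k.+1 < p)%N) : ordS k = Ordinal kp.
  by apply: val_inj; rewrite /= modn_small.
have ordSo (k : 'I_p) : k = p.-1 :> nat -> ordS k = o.
  by move=> kp; apply: val_inj; rewrite /= kp prednK // modnn o0.
have lastp : (p.-1 < p)%N by rewrite prednK.
have lowerS (k : 'I_p) (kp : (k.+1 < p)%N) : lower s (ordS k) (y (ordS k)) =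
    ('i%C / (if s then 1 else q) * (qnum q k.+1 / q ^+ k)) *: y (Ordinal kp).
  by rewrite (ordSE _ kp) /lower /= scalerA.
have lower0 (k : 'I_p) : k = p.-1 :> nat -> lower s (ordS k) (y (ordS k)) =
    ('i%C / (if s then 1 else q) * (pderiv_coef * q)) *: pderiv s (y o).
  by move=> kp; rewrite (ordSo _ kp) /lower o0 scalerA.
split=> [h|[hy hd] k]; last first.
  have [kp|kp] := ltnP k.+1 p.
    by rewrite lowerS hy (hy k) !scalerA /= lower_eigen_coefS.
  have kE : k = p.-1 :> nat.
    by apply/eqP; rewrite eqn_leq -ltnS prednK // ltn_ord -ltnS prednK.
  by rewrite lower0 // hd (hy k) !scalerA kE eigen_coef_last.
have hy (k : 'I_p) : y k = eigen_coef s chi k *: y o.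
  case: k => k kp /=; elim: k kp => [|k IH] kp.
    by rewrite eigen_coef0 scale1r; congr y; apply: val_inj.
  have c0 : 'i%C / (if s then 1 else q) * (qnum q k.+1 / q ^+ k) != 0.
    rewrite mulf_neq0 // mulf_neq0 ?invr_neq0 ?expf_neq0 //.
    exact: (qnum_neq0 p_odd p_gt2 q_prim).
  apply: (scalerI c0); have := h (Ordinal (ltnW kp)).
  by rewrite lowerS (IH (ltnW kp)) /= !scalerA lower_eigen_coefS.
split=> //; have := h (Ordinal lastp).
rewrite lower0 // (hy (Ordinal lastp)) scalerA /= eigen_coef_last.
rewrite -[RHS]scalerA => /scalerI; apply.
by rewrite mulf_neq0 // mulf_neq0.
Qed.

(** The equation for + constrains each row with b fixed, the one for - each column with a fixed.
    Going from (a, b) to (o, b) and then to (o, o) reduces Y to one function satisfying both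
    differential equations, which [pderiv_eigen] solves. *)
Lemma eigenfunctionP (chi : bool -> R[i]) Y :
  (forall s, rho (pgen' p q qhalf s) Y = chi s *: Y) <->
  exists c, Y = c *: (qexp ((- 'i%C * chi true) *: eta true)
           * qexp ((- 'i%C * q * chi false) *: eta false)
           * qplane_fun p q (expwave true ('i%C * chi true ^+ p))
           * qplane_fun p q (expwave false ('i%C * chi false ^+ p))).
Proof.
pose o : 'I_p := Ordinal p_gt0.
have lowT b := @lower_eigenP true (chi true) o (fun a => Y (a, b)) erefl.
have lowF a := @lower_eigenP false (chi false) o (fun b => Y (a, b)) erefl.
have pdP := pderiv_eigen (fun s => 'i%C * chi s ^+ p).
set w := expwave true _; set w' := expwave false _; rewrite -/w -/w' in pdP.
pose e a b := eigen_coef true (chi true) a * eigen_coef false (chi false) b.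
have coefE c m : (c *: (qexp ((- 'i%C * chi true) *: eta true)
    * qexp ((- 'i%C * q * chi false) *: eta false)
    * qplane_fun p q w * qplane_fun p q w')) m = e m.1 m.2 *: (c *: (w * w')).
  by rewrite qexp_mulE ffunE sum_monoE scalerA mulrC -scalerA.
split=> [h|[c YE]].
  have hT b := (lowT b).1 (fun k => etrans (esym (rho_pgen'_trueE Y k b))
    (etrans (congr1 (fun X : A => X (k, b)) (h true)) (ffunE _ _))).
  have hF a := (lowF a).1 (fun k => etrans (esym (rho_pgen'_falseE Y a k))
    (etrans (congr1 (fun X : A => X (a, k)) (h false)) (ffunE _ _))).
  have [|c Yo] := (pdP (Y (o, o))).1.
    by case; [exact: (hT o).2|exact: (hF o).2].
  exists c; apply/ffunP => -[a b]; rewrite coefE -Yo.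
  by rewrite (hT b).1 (hF o).1 scalerA.
(* For the converse, every coefficient of Y is a scalar multiple of the same product of
   exponentials, so all of them satisfy the differential equations. *)
have pdY s (k : R[i]) : pderiv s (k *: (c *: (w * w'))) =
    ('i%C * chi s ^+ p) *: (k *: (c *: (w * w'))).
  rewrite pderivZ ((pdP (c *: (w * w'))).2 (ex_intro _ c erefl) s).
  by rewrite [LHS]scalerA [k * _]mulrC -[LHS]scalerA.
have Ym m : Y m = e m.1 m.2 *: (c *: (w * w')) by rewrite YE coefE.
case; apply/ffunP => -[a b]; rewrite ffunE.
  rewrite rho_pgen'_trueE; apply: (lowT b).2; split=> [k|]; rewrite !Ym ?pdY //.
  by rewrite scalerA /e /= eigen_coef0 mul1r.
rewrite rho_pgen'_falseE; apply: (lowF a).2; split=> [k|]; rewrite !Ym ?pdY //.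
by rewrite scalerA /e /= eigen_coef0 mulr1 mulrC.
Qed.
End RightRepresentation.

(** * Nonzero eigenfunctions and nonzero constants *)

Theorem proposition5 (R : realType) (p : nat) (q qhalf chip chim : R[i])
  (rho : Uqe11 p q -> qplane (smoothFun R) p q -> qplane (smoothFun R) p q)
  (Y : qplane (smoothFun R) p q) :
  (3 <= p)%N -> odd p ->
  p.-primitive_root q -> qhalf ^+ 2 = q -> qhalf ^+ p = -1 ->
  right_rep qhalf rho ->
  (Y != 0 /\
   rho (pgen' p q qhalf true) Y = chip *: Y /\
   rho (pgen' p q qhalf false) Y = chim *: Y) <->
  (exists c : R[i], c != 0 /\
   Y = c *: (qexp ((- 'i%C * chip) *: eta (smoothFun R) p q true)
           * qexp ((- 'i%C * q * chim) *: eta (smoothFun R) p q false)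
           * qplane_fun p q (expwave true ('i%C * chip ^+ p))
           * qplane_fun p q (expwave false ('i%C * chim ^+ p)))).
Proof.
move=> p3 p_odd q_prim qhalfE _ rhoP.
have eigP := eigenfunctionP p_odd p3 q_prim qhalfE rhoP
  (fun s => if s then chip else chim).
split=> [[Y0 [hT hF]]|[c [c0 YE]]].
  have [|c YE] := (eigP Y).1; first by case.
  exists c; split=> //; apply: contraNneq Y0 => c0.
  by rewrite YE c0 scale0r.
have h := (eigP Y).2 (ex_intro _ c YE).
split; last by split; [exact: (h true)|exact: (h false)].
(* Y is nonzero because its coefficient at eta_+^0 eta_-^0 is c times a product of two exponentials,
   which are units; if that product vanished, so would 1. *)
apply/eqP => Y0; have p0 : (0 < p)%N by rewrite (leq_trans _ p3).
pose o := Ordinal p0; set w := expwave true _ in YE; set w' := expwave false _ in YE.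
have : Y (o, o) = c *: (w * w').
  rewrite YE qexp_mulE ffunE sum_monoE /= qexp_coef0 !expr0 !mulr1.
  by rewrite scale1r.
rewrite Y0 ffunE => /esym/eqP; rewrite scaler_eq0 (negbTE c0) /= => /eqP ww0.
have := oner_neq0 (smoothFun R); rewrite -[1]mulr1.
rewrite -{1}(expwaveN true ('i%C * chip ^+ p)) -/w.
by rewrite -(expwaveN false ('i%C * chim ^+ p)) -/w' mulrACA ww0 mul0r eqxx.
Qed.
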